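(* Let $1\le k\le n$ and let $A=(a_{ij})$ be a real symmetric $n\times n$ matrix such that $a_{11}<0$, the submatrix $(a_{ij})_{2\le i,j\le n}$ is diagonal, and $\lambda(A)\in\Gamma_k$. Then for every integer $l$ with $0\le l<k$, $$\frac{\partial}{\partial a_{11}}\left[\frac{\sigma_k(A)}{\sigma_l(A)}\right]\ \ge\ \frac{n}{k}\,\frac{k-l}{n-l}\,\frac{1}{n-k+1}\sum_{i=1}^n\frac{\partial}{\partial a_{ii}}\left[\frac{\sigma_k(A)}{\sigma_l(A)}\right],$$ and $$\sum_{i=1}^n\frac{\partial}{\partial a_{ii}}\left[\frac{\sigma_k(A)}{\sigma_l(A)}\right]\ \ge\ \frac{k-l}{k}\,\frac{1}{C_n^l}\,(-a_{11})^{k-l-1}.$$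
   Context: For $\lambda\in\mathbb{R}^n$, $\sigma_j(\lambda)=\sum_{1\le i_1<\cdots<i_j\le n}\lambda_{i_1}\cdots\lambda_{i_j}$ and $\sigma_0=1$. For a symmetric matrix $A$, $\lambda(A)\in\mathbb{R}^n$ is the vector of eigenvalues of $A$ and $\sigma_j(A)=\sigma_j(\lambda(A))$, regarded as a function of the entries of $A$. $\Gamma_k=\{\lambda\in\mathbb{R}^n:\sigma_i(\lambda)>0 \text{ for all } 1\le i\le k\}$. $C_n^l=\frac{n!}{l!(n-l)!}$. *)

(* Defs.v *)
From HB Require Import structures.
From mathcomp Require Import all_boot all_order all_algebra.
From mathcomp Require Import all_classical all_reals all_analysis.

Set Implicit Arguments.
Unset Strict Implicit.
Unset Printing Implicit Defensive.

Import Order.TTheory GRing.Theory Num.Theory.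
Import numFieldNormedType.Exports.

Local Open Scope classical_set_scope.
Local Open Scope ring_scope.

Definition sigma (R : realType) (n j : nat) (lam : 'rV[R]_n) : R :=
  \sum_(S : {set 'I_n} | #|S| == j) \prod_(i in S) lam ord0 i.

Definition Gamma (R : realType) (n k : nat) : set 'rV[R]_n :=
  [set lam | forall i : nat, (1 <= i <= k)%N -> 0 < sigma i lam].

(* Eigenvalues are listed with algebraic multiplicity, hence through the
   splitting of the characteristic polynomial. *)
Definition eigenvalue_vector (R : realType) (n : nat) (A : 'M[R]_n)
    (lam : 'rV[R]_n) : Prop :=
  char_poly A = \prod_(i < n) ('X - (lam ord0 i)%:P).

(* A vector of eigenvalues always exists when A is symmetric, and it is unique
   up to the order of its entries, which sigma and Gamma ignore.  The value 0
   is only taken when char_poly A does not split over R. *)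
Definition eigenvalues (R : realType) (n : nat) (A : 'M[R]_n) : 'rV[R]_n :=
  xget 0 [set lam | eigenvalue_vector A lam].

Definition sigma_mx (R : realType) (n j : nat) (A : 'M[R]_n) : R :=
  sigma j (eigenvalues A).

Definition sigma_quotient (R : realType) (n k l : nat) (A : 'M[R]_n) : R :=
  sigma_mx k A / sigma_mx l A.

(* The partial derivative with respect to the diagonal entry a_ii is the
   derivative in the direction of the matrix unit E_ii, along which symmetric
   matrices stay symmetric. *)
Definition partial_diag (R : realType) (n : nat) (f : 'M[R]_n.+1 -> R)
    (i : 'I_n.+1) (A : 'M[R]_n.+1) : R :=
  'D_(delta_mx i i) f A.

(* Main.v *)
Require Import Defs.
From HB Require Import structures.
From mathcomp Require Import all_boot all_order all_algebra.
From mathcomp Require Import all_classical all_reals all_analysis.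
From mathcomp Require Import complex polyorder zify ring lra.

Set Implicit Arguments.
Unset Strict Implicit.
Unset Printing Implicit Defensive.

Import Order.TTheory GRing.Theory Num.Theory.
Import numFieldNormedType.Exports.

Local Open Scope ring_scope.

(** The matrix [A] is an arrowhead: a corner [a < 0], a border [b] and a diagonal
    block [D].  Let [S_j] be the sum of the principal minors of size [j] of [A],
    that is [sigma_j] of its eigenvalues, and [s_j] the same for [D].

    Along [A + t E_ii] the sum [S_j] is affine, with slope the minor sum of size
    [j - 1] of the matrix without its index [i]; these slopes add up to
    [(n - j + 1) S_{j-1}].  The derivatives of [S_k / S_l] are therefore explicit:
    the one at the corner is [(s_{k-1} S_l - S_k s_{l-1}) / S_l^2], and the sum of
    all of them is [((n-k+1) S_{k-1} S_l - (n-l+1) S_k S_{l-1}) / S_l^2]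
    ([partial_diag_sigma_quotient], [sum_minor_sum_pminor]).

    Three facts then suffice.
    - Newton's inequalities for the minor sums of a symmetric matrix
      ([newton_minor_sum]): the characteristic polynomial splits over the reals, so
      do its derivatives, and for a split polynomial the inequality between the
      first three coefficients is Cauchy-Schwarz.
    - If the first [k] minor sums of a symmetric matrix are positive, then so are
      the first [k - 1] ones of its principal submatrices, and the quotients of
      minor sums increase with the diagonal entries ([pminor_Gamma]).  This follows
      from Newton's inequality on the line [A + t E_ii] alone.
    - The expansion [S_j = s_j + a s_{j-1} - \sum_i b_i^2 sigma_{j-2}(D without i)]
      ([minor_sum_arrowhead]).

    As [a < 0], the expansion shows that [D] lies in [Gamma_k], that [S_j <= s_j]
    and that [s_j >= - a s_{j-1}].  It also gives
    [k (n - l) S_k s_{l-1} <= l (n - k) s_{k-1} S_l], by comparing separately the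
    three parts of the expansion ([arrowhead_corner_bound]).  So the corner
    derivative is at least [n (k - l) / (k (n - l)) s_{k-1} / S_l], while the sum of
    all derivatives is at most [(n - k + 1) S_{k-1} / S_l]: this is the first
    inequality.  For the second one, Newton-Maclaurin bounds the sum from below by
    [(k - l) / k (n - k + 1) S_{k-1} / S_l]; here [(n - k + 1) S_{k-1}] is a sum of
    positive minor sums, one of which is
    [s_{k-1} >= (- a)^(k-1-l) s_l >= (- a)^(k-1-l) S_l]. *)

(** * Split real polynomials and Newton's inequalities *)

(** The linear factors over [R[i]] all come from [R], and the embedding of
    polynomials is injective. *)
Lemma splits_of_real_roots (R : rcfType) (p : {poly R}) :
    p \is monic ->
    (forall z : R[i], root (map_poly (real_complex R) p) z -> complex.Im z = 0) ->
  exists s : seq R, p = \prod_(x <- s) ('X - x%:P).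
Proof.
move=> p_monic p_real.
have [r Dp] := closed_field_poly_normal (map_poly (real_complex R) p).
rewrite lead_coef_map (monicP p_monic) rmorph1 scale1r in Dp.
exists [seq complex.Re z | z <- r].
apply: (map_poly_inj (real_complex R)); rewrite Dp rmorph_prod /= big_map.
apply: eq_big_seq => z zr; rewrite map_polyXsubC; congr ('X - _%:P).
have /p_real : root (map_poly (real_complex R) p) z.
  by rewrite Dp root_prod_XsubC.
by case: z {zr} => a b /= ->.
Qed.

(** This is Gauss-Lucas for real roots: with [f] the product,
    [f' / f = \sum 1 / (z - x)] has imaginary part of the sign opposite to that
    of [z], so it cannot vanish off the real line.  Multiplying by [|f|^2]
    avoids the division and makes the induction on the roots polynomial. *)
Lemma Im_deriv_conj_lt0 (R : rcfType) (s : seq R) (z : R[i]) :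
    complex.Im z != 0 -> (0 < size s)%N ->
  let f := map_poly (real_complex R) (\prod_(x <- s) ('X - x%:P)) in
  complex.Im z * complex.Im (f^`().[z] * conjc f.[z]) < 0.
Proof.
move=> Iz; set F := fun s : seq R => map_poly (real_complex R)
  (\prod_(x <- s) ('X - x%:P)).
have step x t : F (x :: t) = ('X - (x%:C%C)%:P) * F t.
  by rewrite /F big_cons rmorphM /= map_polyXsubC.
have key x t : complex.Im z * complex.Im ((F (x :: t))^`().[z] * conjc (F (x :: t)).[z]) =
    - (complex.Im z) ^+ 2 * ((complex.Re (F t).[z]) ^+ 2 + (complex.Im (F t).[z]) ^+ 2)
    + ((complex.Re z - x) ^+ 2 + (complex.Im z) ^+ 2)
      * (complex.Im z * complex.Im ((F t)^`().[z] * conjc (F t).[z])).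
  rewrite step derivM derivXsubC mul1r !hornerE /=.
  case: (_.[z]) => a b; case: (_.[z]) => c d; case: z {Iz} => u v /=; ring.
have nz t : (F t).[z] != 0.
  elim: t => [|x t IH]; first by rewrite /F big_nil rmorph1 hornerC oner_neq0.
  rewrite step hornerM mulf_neq0 // hornerXsubC subr_eq0.
  by apply: contraNneq Iz => ->.
have pos t : 0 < (complex.Re (F t).[z]) ^+ 2 + (complex.Im (F t).[z]) ^+ 2.
  rewrite -ltcR add_Re2_Im2; apply: exprn_gt0.
  by rewrite normr_gt0.
have Iz2 : 0 < complex.Im z ^+ 2 by rewrite exprn_even_gt0.
have le0 t : complex.Im z * complex.Im ((F t)^`().[z] * conjc (F t).[z]) <= 0.
  elim: t => [|x t IH].
    by rewrite /F big_nil rmorph1 derivC hornerC mul0r mulr0.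
  rewrite key mulNr addrC subr_le0 (@le_trans _ _ 0) //.
    by rewrite mulr_ge0_le0 // addr_ge0 // sqr_ge0.
  by rewrite mulr_ge0 // ltW.
case: s => // x t _ /=; rewrite -/(F _) key mulNr addrC subr_lt0.
rewrite (@le_lt_trans _ _ 0) //; last by rewrite mulr_gt0.
by rewrite mulr_ge0_le0 // addr_ge0 // sqr_ge0.
Qed.

(** Rolle's theorem with multiplicities: by [Im_deriv_conj_lt0] the derivative has
    no complex root off the real line, hence it splits. *)
Lemma deriv_prod_XsubC (R : rcfType) (s : seq R) :
    (0 < size s)%N ->
  exists2 s' : seq R, size s' = (size s).-1 &
    (\prod_(x <- s) ('X - x%:P))^`()
    = (size s)%:R *: \prod_(x <- s') ('X - x%:P).
Proof.
move=> s_gt0; set f := \prod_(x <- s) _.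
have n_neq0 : (size s)%:R != 0 :> R by rewrite pnatr_eq0 -lt0n.
have size_f : size f = (size s).+1 by rewrite size_prod_XsubC.
have f_monic : f \is monic by apply: monic_prod_XsubC.
have size_f' : size f^`() = size s by rewrite size_deriv size_f.
have lead_f' : lead_coef f^`() = (size s)%:R.
  rewrite lead_coefE size_f' coef_deriv prednK // -mulr_natr.
  by move: f_monic; rewrite monicE lead_coefE size_f /= => /eqP->; rewrite mul1r.
set g := (size s)%:R^-1 *: f^`().
have g_monic : g \is monic by rewrite monicE lead_coefZ lead_f' mulVf.
have [|s' Dg] := splits_of_real_roots g_monic.
  move=> z; rewrite /g map_polyZ rootZ /=; last first.
    by rewrite fmorph_eq0 invr_eq0.
  move/eqP=> f'z0; apply/eqP; apply/negP => /negP Iz.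
  have := Im_deriv_conj_lt0 Iz s_gt0; rewrite /= -/f deriv_map f'z0.
  by rewrite mul0r mulr0 ltxx.
exists s'; last by rewrite -Dg scalerA mulfV // scale1r.
have := congr1 (fun p : {poly R} => size p) Dg.
by rewrite size_scale ?invr_eq0 // size_f' size_prod_XsubC => ->.
Qed.

(** This is the Cauchy-Schwarz inequality for the [N] values at [0] of the
    polynomials [f / ('X - x)], [x] a root: their sum is [f`_1] and the sum of
    their squares is [f`_1 ^+ 2 - 2 * f`_0 * f`_2]. *)
Lemma newton_at0 (R : realFieldType) (s : seq R) :
  let f := \prod_(x <- s) ('X - x%:P) in
  f`_1 ^+ 2 <= (size s)%:R * (f`_1 ^+ 2 - 2 * f`_0 * f`_2).
Proof.
elim: s => [|x s IH] /=; first by rewrite big_nil !coefC /= expr0n /= mul0r.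
case: s IH => [_|y s].
  by rewrite big_seq1 !coefB !coefX !coefC /=; lra.
have : (0 < size (y :: s))%N by [].
move: (y :: s) => {y}s; move: (size s) => N N0 /= IH.
rewrite big_cons; move: (\prod_(y <- s) _) IH => h IH.
rewrite mulrBl !coefB !coefXM !coefCM /=.
have {N0} : 0 < N%:R :> R by rewrite ltr0n.
rewrite -[N.+1]addn1 natrD; move: N%:R IH => M.
move: h`_0 h`_1 h`_2 => a b c IH M0.
have sq : 0 <= (M * a + x * b) ^+ 2 by apply: sqr_ge0.
have x2 : 0 <= x ^+ 2 by apply: sqr_ge0.
rewrite -(ler_pM2l M0) -subr_ge0.
have -> : M * ((M + 1) * ((a - x * b) ^+ 2 - 2 * (0 - x * a) * (b - x * c)))
     - M * (a - x * b) ^+ 2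
   = (M * a + x * b) ^+ 2
     + x ^+ 2 * ((M + 1) * (M * (b ^+ 2 - 2 * a * c) - b ^+ 2)) by ring.
apply: addr_ge0 => //; apply: mulr_ge0 => //; apply: mulr_ge0; first by lra.
by rewrite subr_ge0.
Qed.

(** Newton's inequality at the coefficients [i], [i+1], [i+2] of a split
    polynomial is the case [i = 0] for its [i]-th derivative, which splits. *)
Lemma newton_coef (R : rcfType) (s : seq R) (i : nat)
    (f := \prod_(x <- s) ('X - x%:P)) (n := (size s)%:R) :
  (n - i%:R) * i.+2%:R * (f`_i * f`_i.+2)
  <= (n - i.+1%:R) * i.+1%:R * f`_i.+1 ^+ 2.
Proof.
have [le_si|lt_is] := leqP (size s) i.+1.
  have f2 : f`_i.+2 = 0 by rewrite nth_default // size_prod_XsubC.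
  rewrite f2 !mulr0; move: le_si; rewrite leq_eqVlt => /orP[/eqP e|lt].
    by rewrite /n e subrr !mul0r.
  have -> : f`_i.+1 = 0 by rewrite nth_default // size_prod_XsubC.
  by rewrite expr0n mulr0.
have [c [s' [c0 ss' Df]]] : exists c (s' : seq R), [/\ 0 < c,
    size s' = (size s - i)%N & f^`(i) = c *: \prod_(x <- s') ('X - x%:P)].
  move: (ltnW (ltnW lt_is)); elim: i {lt_is} => [|i IH] lt.
    by exists 1, s; rewrite subn0 derivn0 scale1r.
  have [c [t [c0 st Dt]]] := IH (ltnW lt).
  have t0 : (0 < size t)%N by rewrite st subn_gt0.
  have [t' st' Dt'] := deriv_prod_XsubC t0.
  exists (c * (size t)%:R), t'; split.
  - by rewrite mulr_gt0 // ltr0n.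
  - by rewrite st' st subnS.
  - by rewrite derivnS Dt derivZ Dt' scalerA.
have /= := newton_at0 s'; set g := \prod_(x <- s') _ in Df *.
have cg j : c * g`_j = f`_(i + j) * ((i + j) ^_ i)%:R.
  by rewrite mulr_natr -coef_derivn Df coefZ.
have c2 : 0 < c ^+ 2 by rewrite exprn_gt0.
rewrite -(ler_pM2l c2) => H.
have {H} : (c * g`_1) ^+ 2 <= (size s')%:R *
    ((c * g`_1) ^+ 2 - 2 * (c * g`_0) * (c * g`_2)).
  by apply: le_trans (le_trans H _); rewrite le_eqVlt; apply/orP; left;
     apply/eqP; ring.
rewrite !cg ss' natrB; last exact: ltnW (ltnW lt_is).
rewrite addn0 addn1 addn2 ffactnn.
have e1 : (i.+1 ^_ i)%:R = i.+1%:R * i`!%:R :> R.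
  by rewrite -natrM -factS -(@ffact_fact i.+1 i) // subSnn muln1.
have e2 : 2 * (i.+2 ^_ i)%:R = i.+2%:R * (i.+1%:R * i`!%:R) :> R.
  rewrite -!natrM -!factS -(@ffact_fact i.+2 i) ?leqW //.
  by rewrite -(addn2 i) addKn mulnC.
have fi : 0 < i`!%:R :> R by rewrite ltr0n fact_gt0.
have i1 : 0 < i.+1%:R :> R by rewrite ltr0n.
rewrite e1; move: (i.+2 ^_ i)%:R e2 => w e2 H.
rewrite -(ler_pM2l (mulr_gt0 i1 (exprn_gt0 2 fi))).
rewrite -subr_ge0 in H; rewrite -subr_ge0; apply: le_trans H _.
rewrite le_eqVlt; apply/orP; left; apply/eqP.
move: f`_i f`_i.+1 f`_i.+2 i`!%:R i.+2%:R e2 => a b d q k.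
rewrite -[i.+1]addn1 natrD; move: i%:R => j e2.
have -> : 2 * (a * q) * (d * w) = a * q * d * (2 * w) by ring.
by rewrite e2; ring.
Qed.

(** Over [R[i]] the matrix is Hermitian, so the spectral theorem diagonalizes it
    with real diagonal entries. *)
Lemma sym_char_poly_splits (R : rcfType) (n : nat) (A : 'M[R]_n) :
  A^T = A -> exists s : seq R, char_poly A = \prod_(x <- s) ('X - x%:P).
Proof.
move=> Asym; apply: splits_of_real_roots; first exact: char_poly_monic.
set AC := map_mx (real_complex R) A.
have AC_herm : AC \is hermsymmx.
  apply: realsym_hermsym.
    by apply/is_hermitianmxP; rewrite expr0 scale1r map_mx_id // map_trmx Asym.
  by apply/mxOverP => i j; rewrite mxE; apply/complex_realP; exists (A i j).
have /orthomx_spectralP AC_diag := hermitian_normalmx AC_herm.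
have /mxOverP d_real := hermitian_spectral_diag_real AC_herm.
move=> z; rewrite map_char_poly -/AC -eigenvalue_root_char.
case/eigenvalueP=> v v_eig v_neq0.
set P := spectralmx AC in AC_diag; set d := spectral_diag AC in AC_diag d_real.
have P_unit : P \in unitmx by apply: spectral_unit.
have [w w_eig w_neq0] : exists2 w : 'rV_n, w *m diag_mx d = z *: w & w != 0.
  exists (v *m invmx P).
    by rewrite scalemxAl -v_eig AC_diag !mulmxA mulmxK.
  by apply: contraNneq v_neq0 => w0; rewrite -(mulmxKV P_unit v) w0 mul0mx.
have /rV0Pn[j wj] := w_neq0.
have /rowP/(_ j) := w_eig; rewrite mul_mx_diag !mxE => /eqP.
rewrite mulrC -subr_eq0 -mulrBl mulf_eq0 (negPf wj) orbF subr_eq0 => /eqP <-.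
by have /complex_realP[x ->] := d_real 0 j.
Qed.

(** * Sums of principal minors *)

Lemma deriv_prod_uniq (R : comNzRingType) (I : eqType) (r : seq I)
    (F : I -> {poly R}) : uniq r ->
  (\prod_(i <- r) F i)^`()
  = \sum_(i <- r) \prod_(j <- r) (if j == i then (F j)^`() else F j).
Proof.
elim: r => [_|i r IH /= /andP[ir r_uniq]]; first by rewrite !big_nil derivC.
rewrite big_cons derivM (IH r_uniq) big_cons big_cons eqxx mulr_sumr.
congr (_ * _ + _).
  by apply: eq_big_seq => j jr; case: eqVneq => // ji; rewrite -ji jr in ir.
apply: eq_big_seq => j jr; rewrite big_cons ifN //.
by apply: contraNneq ir => ->.
Qed.

(** The product rule in each term of the Leibniz expansion, regrouped by the row
    that is differentiated. *)
Lemma deriv_det (R : comNzRingType) (n : nat) (M : 'M[{poly R}]_n) :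
  (\det M)^`() =
  \sum_i \det (\matrix_(a, b) (if a == i then (M a b)^`() else M a b)).
Proof.
rewrite /determinant exchange_big /= raddf_sum; apply: eq_bigr => s _.
have -> : (-1) ^+ perm.odd_perm s
    = ((-1) ^+ perm.odd_perm s)%:P :> {poly R} by rewrite rmorph_sign.
rewrite -mulr_sumr !mul_polyC /= derivZ; congr (_ *: _).
rewrite deriv_prod_uniq ?index_enum_uniq //; apply: eq_bigr => i _.
by apply: eq_bigr => j _; rewrite mxE.
Qed.

(** The polynomial [\det (1 + 'X A)], whose coefficients are the sums of the
    principal minors of [A] of each size.  Compared with [char_poly], it needs no
    signs and no reindexing. *)
Definition minor_poly (R : comNzRingType) (n : nat) (A : 'M[R]_n) : {poly R} :=
  \det (1%:M + 'X *: map_mx polyC A).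

Definition minor_sum (R : comNzRingType) (n : nat) (j : nat) (A : 'M[R]_n) : R :=
  (minor_poly A)`_j.

Definition pminor (R : Type) (n : nat) (i : 'I_n) (A : 'M[R]_n) : 'M[R]_n.-1 :=
  row' i (col' i A).

Lemma row'_col'_minor_mx (R : comNzRingType) (n : nat) (i : 'I_n) (A : 'M[R]_n) :
  row' i (col' i (1%:M + 'X *: map_mx polyC A))
  = 1%:M + 'X *: map_mx polyC (pminor i A).
Proof. by apply/matrixP => a b; rewrite !mxE (inj_eq lift_inj). Qed.

Lemma cofactor_diag (R : comNzRingType) (n : nat) (i : 'I_n) (M : 'M[R]_n) :
  cofactor M i i = \det (row' i (col' i M)).
Proof. by rewrite /cofactor -signr_odd oddD addbb mul1r. Qed.

Lemma det_add_delta (R : comNzRingType) (n : nat) (i : 'I_n) (M : 'M[R]_n) (t : R) :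
  \det (M + t *: delta_mx i i) = \det M + t * \det (row' i (col' i M)).
Proof.
have cof j : cofactor (M + t *: delta_mx i i) i j = cofactor M i j.
  congr (_ * \det _); apply/matrixP => a b; rewrite !mxE.
  by rewrite eq_sym (negPf (neq_lift _ _)) mulr0 addr0.
rewrite (expand_det_row _ i) (eq_bigr (fun j => M i j * cofactor M i j
    + (if j == i then t * cofactor M i i else 0))); last first.
  move=> j _; rewrite cof !mxE eqxx /= mulrDl; congr (_ + _).
  by case: eqVneq => [->|_]; rewrite ?mulr1 // mulr0 mul0r.
by rewrite big_split /= -(expand_det_row M i) -big_mkcond /= big_pred1_eq cofactor_diag.
Qed.

Lemma minor_poly_add_delta (R : comNzRingType) (n : nat) (i : 'I_n)
    (A : 'M[R]_n) (t : R) :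
  minor_poly (A + t *: delta_mx i i)
  = minor_poly A + 'X * t%:P * minor_poly (pminor i A).
Proof.
rewrite /minor_poly -row'_col'_minor_mx -det_add_delta; congr (\det _).
apply/matrixP => a b; rewrite !mxE polyCD polyCM mulrDr addrA mulrA.
by congr (_ + _ * _); rewrite polyCMn.
Qed.

Lemma minor_sum0 (R : comNzRingType) (n : nat) (A : 'M[R]_n) :
  minor_sum 0 A = 1.
Proof.
rewrite /minor_sum -horner_coef0 /minor_poly -horner_evalE -det_map_mx.
rewrite -[RHS](det1 R n); congr (\det _); apply/matrixP => a b.
by rewrite !mxE /= horner_evalE !hornerE hornerMn hornerC.
Qed.

(** The derivative of [minor_sum j] in the [i]-th diagonal entry. *)
Definition dminor_sum (R : comNzRingType) (n j : nat) (i : 'I_n) (A : 'M[R]_n) : R :=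
  if j is j'.+1 then minor_sum j' (pminor i A) else 0.

Lemma minor_sum_add_delta (R : comNzRingType) (n : nat) (i : 'I_n) (j : nat)
    (A : 'M[R]_n) (t : R) :
  minor_sum j (A + t *: delta_mx i i) = minor_sum j A + t * dminor_sum j i A.
Proof.
case: j => [|j] /=; first by rewrite !minor_sum0 mulr0 addr0.
by rewrite /minor_sum minor_poly_add_delta coefD -mulrA coefXM coefCM.
Qed.

(** Euler's identity for the homogeneous polynomial [\det (Y + X A)], read off
    from the row by row derivative of [minor_poly]. *)
Lemma sum_minor_sum_pminor (R : comNzRingType) (n j : nat) (A : 'M[R]_n) :
  \sum_i minor_sum j (pminor i A) = (n%:R - j%:R) * minor_sum j A.
Proof.
set M : 'M[{poly R}]_n := 1%:M + 'X *: map_mx polyC A.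
have row_i i : 'X * \det (\matrix_(a, b) (if a == i then (M a b)^`() else M a b))
    = minor_poly A - minor_poly (pminor i A).
  set N := \matrix_(a, b) _.
  rewrite [minor_poly _]/minor_poly -/M [in RHS](expand_det_row _ i).
  rewrite (expand_det_row N i) mulr_sumr.
  rewrite /minor_poly -row'_col'_minor_mx -cofactor_diag -/M.
  have -> : cofactor M i i = \sum_b (i == b)%:R * cofactor M i b.
    rewrite (bigD1 i) //= eqxx mul1r big1 ?addr0 // => b.
    by rewrite eq_sym => /negPf->; rewrite mul0r.
  rewrite -sumrB; apply: eq_bigr => b _; rewrite mulrA -mulrBl.
  congr (_ * _); last first.
    congr (_ * \det _); apply/matrixP => a c; rewrite !mxE.
    by rewrite eq_sym (negPf (neq_lift _ _)).
  rewrite !mxE eqxx derivD -mulr_natl mulr1 derivMn derivC mul0rn add0r.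
  rewrite derivM derivX derivC mulr0 addr0 mul1r.
  by rewrite addrAC subrr add0r.
have : 'X * (minor_poly A)^`() = minor_poly A *+ n - \sum_i minor_poly (pminor i A).
  rewrite /minor_poly deriv_det mulr_sumr (eq_bigr _ (fun i _ => row_i i)).
  by rewrite sumrB sumr_const card_ord.
move/(congr1 (fun p : {poly R} => p`_j)).
rewrite coefXM coefB coefMn [X in _ - X]coef_sum -/(minor_sum j A) => e.
have {e} : j%:R * minor_sum j A = n%:R * minor_sum j A - \sum_i minor_sum j (pminor i A).
  rewrite !mulr_natl -e; case: j {e} => [|j]; first by rewrite mulr0n.
  by rewrite coef_deriv.
by rewrite mulrBl => ->; rewrite opprB addrCA subrr addr0.
Qed.

(** * Arrowhead matrices *)

(** Expansion along the first row and then along the first column: a product of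
    an entry of the border row by a non-matching entry of the border column
    multiplies a minor of the diagonal block that has a zero row. *)
Lemma det_arrowhead (R : comNzRingType) (m : nat) (M : 'M[R]_m.+1) :
    is_diag_mx (pminor ord0 M) ->
  \det M = M ord0 ord0 * \det (pminor ord0 M)
    - \sum_i M ord0 (lift ord0 i) * M (lift ord0 i) ord0
             * \det (pminor i (pminor ord0 M)).
Proof.
move=> /is_diag_mxP D_diag; rewrite (expand_det_row _ ord0) big_ord_recl.
rewrite cofactor_diag -sumrN; congr (_ + _); apply: eq_bigr => i _.
rewrite -mulrA -mulrN; congr (_ * _).
case: m M D_diag i => [M D_diag []//|m M D_diag i].
rewrite /cofactor (expand_det_col _ ord0) (bigD1 i) //= big1 ?addr0.
  rewrite /cofactor !mxE (_ : lift (lift ord0 i) ord0 = ord0); last exact: val_inj.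
  rewrite (_ : row' i _ = pminor i (pminor ord0 M)).
    rewrite addn0 /bump /= add0n exprS mulN1r mulNr mulrCA; congr (- (_ * _)).
    by rewrite mulrA -exprMn mulrNN mulr1 expr1n mul1r.
  apply/matrixP => a b; rewrite !mxE; congr (M _ _); apply: val_inj.
  by rewrite /= /bump /= !add1n ltnS addnS.
(* For r != i the minor contains the truncated row i, which is zero. *)
move=> r r_i; rewrite /cofactor.
have [a a_i] : exists a, lift r a = i.
  by case: (unliftP r i) => [a ->|e]; [exists a | rewrite e eqxx in r_i].
rewrite (expand_det_row _ a) big1 ?mulr0 // => b _.
rewrite !mxE a_i (_ : lift (lift ord0 i) (lift ord0 b) = lift ord0 (lift i b)).
  have := D_diag i (lift i b); rewrite !mxE => ->; first by rewrite mul0r.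
  exact: neq_lift.
by apply: val_inj; rewrite /= /bump /= !add1n ltnS addnS.
Qed.

Lemma minor_poly_arrowhead (R : comNzRingType) (m : nat) (A : 'M[R]_m.+1) :
    is_diag_mx (pminor ord0 A) ->
  minor_poly A = (1 + 'X * (A ord0 ord0)%:P) * minor_poly (pminor ord0 A)
    - 'X * ('X * \sum_i (A ord0 (lift ord0 i) * A (lift ord0 i) ord0)%:P
             * minor_poly (pminor i (pminor ord0 A))).
Proof.
move=> /is_diag_mxP A_diag; rewrite {1}/minor_poly det_arrowhead.
  rewrite /pminor !row'_col'_minor_mx -/(minor_poly _) !mxE eqxx; congr (_ - _).
  rewrite !mulr_sumr; apply: eq_bigr => i _.
  rewrite /pminor !row'_col'_minor_mx -/(minor_poly _) !mxE /= polyCM !add0r.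
  by ring.
rewrite [pminor _ _]row'_col'_minor_mx; apply/is_diag_mxP => i j ij.
have := A_diag i j ij; rewrite !mxE => ->.
by rewrite (negPf (_ : i != j)) // mulr0 addr0.
Qed.

Lemma minor_sum_arrowhead (R : comNzRingType) (m j : nat) (A : 'M[R]_m.+1) :
    is_diag_mx (pminor ord0 A) ->
  minor_sum j.+1 A = minor_sum j.+1 (pminor ord0 A)
    + A ord0 ord0 * minor_sum j (pminor ord0 A)
    - \sum_i (A ord0 (lift ord0 i) * A (lift ord0 i) ord0)
        * dminor_sum j i (pminor ord0 A).
Proof.
move=> /minor_poly_arrowhead e; rewrite {1}/minor_sum e coefB mulrDl mul1r coefD.
rewrite -mulrA !coefXM /= coefCM; congr (_ - _).
case: j => [|j] /=; first by rewrite big1 // => i _; rewrite mulr0.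
by rewrite [LHS]coef_sum; apply: eq_bigr => i _; rewrite coefCM.
Qed.

(** * Minor sums of symmetric matrices *)

Lemma poly_eq_nonzero (R : numDomainType) (p q : {poly R}) :
  (forall x : R, x != 0 -> p.[x] = q.[x]) -> p = q.
Proof.
move=> pq; apply/eqP; rewrite -subr_eq0; apply/eqP.
apply: (@roots_geq_poly_eq0 _ _ [seq i.+1%:R | i <- iota 0 (size (p - q))]).
- apply/allP => x /mapP[i _ ->]; rewrite rootE hornerD hornerN pq ?pnatr_eq0 //.
  by rewrite subrr.
- rewrite map_inj_uniq ?iota_uniq // => i j /eqP.
  by rewrite eqr_nat eqSS => /eqP.
- by rewrite size_map size_iota.
Qed.

(** At [t != 0], [\det (1 + t A)] is [(- t) ^ n] times the characteristic
    polynomial at [- t^-1]. *)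
Lemma minor_poly_split (R : numFieldType) (n : nat) (A : 'M[R]_n) (s : seq R) :
    char_poly A = \prod_(x <- s) ('X - x%:P) ->
  minor_poly A = \prod_(x <- s) (1 + x *: 'X).
Proof.
move=> A_s; apply: poly_eq_nonzero => t t0.
have size_s : size s = n.
  have := congr1 (fun p : {poly R} => size p) A_s.
  by rewrite size_char_poly size_prod_XsubC => -[].
have := congr1 (fun p : {poly R} => p.[- t^-1]) A_s.
rewrite /char_poly -horner_evalE -det_map_mx.
have -> : map_mx (horner_eval (- t^-1)) (char_poly_mx A)
    = (- t^-1) *: (1%:M + t *: A).
  apply/matrixP => a b; rewrite !mxE horner_evalE !hornerE /= hornerMn !hornerE.
  by rewrite mulrDr mulr_natr mulrA mulNr mulVf // mulN1r.
rewrite detZ -{1}size_s => e.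
have e' : (minor_poly A).[t] = \det (1%:M + t *: A).
  rewrite /minor_poly -horner_evalE -det_map_mx; congr (\det _).
  by apply/matrixP => a b; rewrite !mxE /= horner_evalE !hornerE hornerMn hornerC.
apply: (@mulfI _ ((- t^-1) ^+ size s)).
  by rewrite expf_neq0 // oppr_eq0 invr_eq0.
rewrite e' e !horner_prod; elim: s {A_s size_s e} => [|x s IH].
  by rewrite !big_nil mul1r.
rewrite !big_cons /= exprS mulrACA IH !hornerE; congr (_ * _).
by rewrite mulrDr mulr1 mulNr mulrCA mulVf // mulr1.
Qed.

Lemma coef_prod_1DZX_gt (R : comNzRingType) (s : seq R) (j : nat) :
  (size s < j)%N -> (\prod_(x <- s) (1 + x *: 'X))`_j = 0.
Proof.
elim: s j => [|x s IH] [|j] //=; first by rewrite big_nil coef1.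
rewrite ltnS => lt_sj; rewrite big_cons mulrDl mul1r coefD -scalerAl coefZ coefXM /=.
by rewrite !IH ?mulr0 ?addr0 // ltnW.
Qed.

Lemma coef_prod_XsubC_rev (R : comNzRingType) (s : seq R) (i j : nat) :
    (i + j = size s)%N ->
  (\prod_(x <- s) ('X - x%:P))`_i
  = (-1) ^+ j * (\prod_(x <- s) (1 + x *: 'X))`_j.
Proof.
elim: s i j => [|x s IH] i j /=.
  by case: i j => [|i] [|j] //; rewrite !big_nil expr0 mul1r.
move=> ij; rewrite !big_cons mulrBl mulrDl mul1r coefB coefD -scalerAl coefZ.
rewrite !coefXM coefCM.
case: i j ij => [|i] [|j]; rewrite ?add0n ?addn0 ?addSn //= => -[ij].
- rewrite (IH 0%N j) ?add0n // (@coef_prod_1DZX_gt _ s j.+1) ?ij // !add0r.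
  by rewrite exprS mulN1r mulNr mulrCA.
- rewrite (IH i 0%N) ?addn0 // mulr0 addr0.
  by rewrite [X in _ - x * X]nth_default ?mulr0 ?subr0 // size_prod_XsubC ij.
- by rewrite (IH i j.+1) // (IH i.+1 j) ?addSnnS // exprS; ring.
Qed.

(** Up to a sign, [minor_sum j] is the coefficient of degree [n - j] of the
    characteristic polynomial, so this is [newton_coef] at the degrees
    [n - j - 2], [n - j - 1] and [n - j]; the signs cancel in pairs. *)
Lemma newton_minor_sum (R : rcfType) (n j : nat) (A : 'M[R]_n) :
    A^T = A ->
  (n%:R - j%:R) * j.+2%:R * (minor_sum j A * minor_sum j.+2 A)
  <= (n%:R - j.+1%:R) * j.+1%:R * minor_sum j.+1 A ^+ 2.
Proof.
move=> /sym_char_poly_splits[s A_s]; rewrite /minor_sum (minor_poly_split A_s).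
have size_s : size s = n.
  have := congr1 (fun p : {poly R} => size p) A_s.
  by rewrite size_char_poly size_prod_XsubC => -[].
have [le_jn|lt_nj] := leqP j.+2 n; last first.
  rewrite (@coef_prod_1DZX_gt _ s j.+2) ?size_s // !mulr0.
  move: lt_nj; rewrite ltnS leq_eqVlt => /orP[/eqP->|lt].
    by rewrite subrr !mul0r.
  by rewrite (@coef_prod_1DZX_gt _ s j.+1) ?size_s // expr0n mulr0.
have nE : n%:R = (n - j.+2)%:R + j.+2%:R :> R by rewrite -natrD subnK.
have /= := newton_coef s (n - j.+2)%N; rewrite size_s.
rewrite (@coef_prod_XsubC_rev _ s (n - j.+2)%N j.+2) ?subnK ?size_s //.
rewrite (@coef_prod_XsubC_rev _ s (n - j.+2).+1 j.+1); last first.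
  by rewrite addSnnS subnK // size_s.
rewrite (@coef_prod_XsubC_rev _ s (n - j.+2).+2 j); last first.
  by rewrite !addSnnS subnK // size_s.
move: nE; set i := (n - j.+2)%N; set e := \prod_(x <- s) _ => nE.
have signs a b : (-1) ^+ j.+2 * a * ((-1) ^+ j * b) = b * a :> R.
  have : (-1) ^+ j * (-1) ^+ j = 1 :> R by rewrite -expr2 sqrr_sign.
  by rewrite 2!exprS; move: ((-1) ^+ j) => w ww;
    transitivity (w * w * (b * a)); [ring | rewrite ww mul1r].
rewrite signs exprMn sqrr_sign mul1r nE.
congr (_ * _ <= _ * _).
  by rewrite -[i.+2]addn2 -[j.+2]addn2 !natrD; ring.
by rewrite -[i.+1]addn1 -[j.+2]addn2 -[j.+1]addn1 !natrD; ring.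
Qed.

Lemma sigma_coef (R : realType) (n j : nat) (lam : 'rV[R]_n) :
  sigma j lam = (\prod_i (1 + lam ord0 i *: 'X))`_j.
Proof.
rewrite (eq_bigr (fun i => lam ord0 i *: 'X + 1)); last by move=> i; rewrite addrC.
rewrite bigA_distr coef_sum /sigma big_mkcond /=; apply: eq_bigr => S _.
rewrite -big_mkcond /= scaler_prod prodr_const coefZ coefXn eq_sym.
by case: eqP => _; rewrite ?mulr1 ?mulr0.
Qed.

(** The eigenvalues chosen by [eigenvalues] are genuine because symmetric
    matrices are diagonalizable over the reals. *)
Lemma sigma_eigenvalues (R : realType) (n j : nat) (A : 'M[R]_n) :
  A^T = A -> sigma j (eigenvalues A) = minor_sum j A.
Proof.
move=> Asym; have [s A_s] := sym_char_poly_splits Asym.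
have size_s : size s = n.
  have := congr1 (fun p : {poly R} => size p) A_s.
  by rewrite size_char_poly size_prod_XsubC => -[].
have : eigenvalue_vector A (eigenvalues A).
  apply: (@xgetPex _ 0 [set lam | eigenvalue_vector A lam]%classic).
  exists (\row_i s`_i); rewrite /= /eigenvalue_vector A_s (big_nth 0) size_s big_mkord.
  by apply: eq_bigr => i _; rewrite mxE.
set lam := eigenvalues A => A_lam; rewrite sigma_coef /minor_sum.
rewrite (@minor_poly_split _ _ A [seq lam ord0 i | i <- index_enum 'I_n]).
  by rewrite big_map.
by rewrite big_map.
Qed.

Lemma minor_sum_gt (R : rcfType) (n j : nat) (A : 'M[R]_n) :
  A^T = A -> (n < j)%N -> minor_sum j A = 0.
Proof.
move=> /sym_char_poly_splits[s A_s] lt_nj; rewrite /minor_sum (minor_poly_split A_s).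
rewrite coef_prod_1DZX_gt //; have := congr1 (fun p : {poly R} => size p) A_s.
by rewrite size_char_poly size_prod_XsubC => -[<-].
Qed.

(** The two numerical factors of Newton's inequality only help, and without them
    the inequality can be used along a line of matrices as a statement about
    quadratic polynomials. *)
Lemma newton_minor_sum_weak (R : rcfType) (n j : nat) (A : 'M[R]_n) :
  A^T = A -> minor_sum j A * minor_sum j.+2 A <= minor_sum j.+1 A ^+ 2.
Proof.
move=> Asym; have [lt_nj|le_jn] := ltnP n j.+2.
  by rewrite (minor_sum_gt Asym lt_nj) mulr0 sqr_ge0.
have := newton_minor_sum j Asym; clear Asym.
have nE : n%:R = (n - j.+2)%:R + j.+2%:R :> R by rewrite -natrD subnK.
move: (minor_sum j A * _) (minor_sum j.+1 A ^+ 2) (sqr_ge0 (minor_sum j.+1 A)) => x y y0.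
move: nE; rewrite -[j.+2]addn2 -[j.+1]addn1 !natrD => ->.
move: (n - (j + 2))%:R (ler0n R (n - (j + 2))) (j%:R) (ler0n R j) => d d0 e e0 H.
have [x0|x0] := lerP x 0; first exact: le_trans x0 y0.
have c0 : 0 < (d + (e + 2) - e) * (e + 2) by rewrite mulr_gt0; lra.
rewrite -(ler_pM2l c0); apply: (le_trans H).
apply: ler_wpM2r => //.
by have := mulr_ge0 d0 e0; nra.
Qed.

(** * Positivity and monotonicity in the diagonal entries *)

(** The heart of the matter is Newton's inequality [x y <= z^2] along a pencil,
    with [x = a0 + t b0], [z = a1 + t b1] and [y = a2 + t b2], at the root
    [t = - a1 / b1] of [z].  There [x >= 0] by the last hypothesis, and the
    claim is [y <= 0].  If [x > 0] this is immediate.  If [x] vanishes there too,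
    it follows from the first order terms at the root. *)
Lemma pencil_step (R : realFieldType) (a0 a1 a2 b0 b1 b2 : R) :
    (forall t, (a0 + t * b0) * (a2 + t * b2) <= (a1 + t * b1) ^+ 2) ->
    0 < a0 -> 0 <= b0 -> 0 < b1 -> a1 * b0 <= a0 * b1 ->
  a2 * b1 <= a1 * b2.
Proof.
move=> newton a0_gt0 b0_ge0 b1_gt0 ratio; set t := - (a1 / b1).
have tb : t * b1 = - a1 by rewrite /t mulNr divfK // gt_eqF.
have {}newton u : (a0 + t * b0 + u * b0) * (a2 + t * b2 + u * b2) <= u ^+ 2 * b1 ^+ 2.
  have := newton (t + u); rewrite !mulrDl tb.
  by rewrite addrA addrA addrA addrN add0r exprMn.
have x_ge0 : 0 <= a0 + t * b0.
  by rewrite -(pmulr_lge0 _ b1_gt0) mulrDl mulrAC tb mulNr subr_ge0.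
suff : a2 + t * b2 <= 0.
  by rewrite -(pmulr_lle0 _ b1_gt0) mulrDl mulrAC tb mulNr subr_le0.
rewrite leNgt; apply/negP; set y := a2 + t * b2 in newton * => y_gt0.
have x0 : a0 + t * b0 = 0.
  apply/le_anti; rewrite x_ge0 andbT -(pmulr_lle0 _ y_gt0).
  by have := newton 0; rewrite !mul0r !addr0 expr0n mul0r.
have b0_gt0 : 0 < b0.
  by rewrite lt0r b0_ge0 andbT; apply: contraPneq a0_gt0 => b00;
     move: x0; rewrite b00 mulr0 addr0 => ->; rewrite ltxx.
(* With x = 0 Newton's inequality at t + u reads b0 * y <= u * w for u > 0, and
   this fails for small u. *)
pose w := b1 ^+ 2 - b0 * b2; pose u := b0 * y / (1 + w ^+ 2).
have w_gt0 : 0 < 1 + w ^+ 2 by rewrite ltr_pwDl // sqr_ge0.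
have by_gt0 : 0 < b0 * y by rewrite mulr_gt0.
have u_gt0 : 0 < u by rewrite divr_gt0.
have uw : u * (1 + w ^+ 2) = b0 * y by rewrite divfK // gt_eqF.
have : b0 * y <= u * w.
  rewrite -(ler_pM2l u_gt0) -subr_ge0.
  have := newton u; rewrite x0 add0r -subr_ge0; congr (0 <= _).
  by rewrite /w; ring.
rewrite -uw ler_pM2l //; apply/negP; rewrite -ltNge.
by have := sqr_ge0 (w - 1); have := sqr_ge0 w; nra.
Qed.

(** Write [S_j] and [T_j] for the minor sums of [M] and of its principal
    submatrix.  Those of [M + t E_ii] are [S_j + t T_{j-1}], so Newton's inequality
    and [pencil_step] turn [S_{j+1} T_{j-1} <= S_j T_j] into
    [S_{j+2} T_j <= S_{j+1} T_{j+1}], and then [T_j > 0] gives [T_{j+1} > 0].  Hence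
    positivity (the submatrix lies in the cone [Gamma_{k-1}]) and the ratio
    inequality (the quotients [sigma_{j+1} / sigma_j] increase with the diagonal
    entries) need a simultaneous induction. *)
Lemma pminor_Gamma (R : rcfType) (n k : nat) (M : 'M[R]_n) (i : 'I_n) :
    M^T = M -> (forall j, (1 <= j <= k)%N -> 0 < minor_sum j M) ->
  (forall j, (j < k)%N -> 0 < minor_sum j (pminor i M)) /\
  (forall j, (j.+1 < k)%N ->
    minor_sum j.+2 M * minor_sum j (pminor i M)
    <= minor_sum j.+1 M * minor_sum j.+1 (pminor i M)).
Proof.
move=> Msym S_gt0.
have newton t j : let P j := minor_sum j (M + t *: delta_mx i i) in
    P j * P j.+2 <= P j.+1 ^+ 2.
  apply: newton_minor_sum_weak.
  by rewrite linearD linearZ /= trmx_delta Msym.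
have positive j : (j.+1 < k)%N -> 0 < minor_sum j (pminor i M) ->
    minor_sum j.+2 M * minor_sum j (pminor i M)
    <= minor_sum j.+1 M * minor_sum j.+1 (pminor i M) ->
    0 < minor_sum j.+1 (pminor i M).
  move=> lt_jk T0 ratio.
  rewrite -(pmulr_rgt0 _ (S_gt0 j.+1 (ltnW lt_jk))).
  by apply: lt_le_trans ratio; rewrite mulr_gt0 // S_gt0.
suff both j : (j < k)%N -> 0 < minor_sum j (pminor i M) /\
    ((j.+1 < k)%N -> minor_sum j.+2 M * minor_sum j (pminor i M)
      <= minor_sum j.+1 M * minor_sum j.+1 (pminor i M)).
  by split=> j lt_jk; [have [] := both j lt_jk | have [_ ->] := both j (ltnW lt_jk)].
elim: j => [k_gt0|j IH lt_jk].
  rewrite minor_sum0; split=> // lt_1k.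
  have := @pencil_step _ 1 (minor_sum 1 M) (minor_sum 2 M) 0 1 (minor_sum 1 (pminor i M)).
  apply=> // [t|]; last by rewrite mulr0 mul1r.
  have /= := newton t 0%N; rewrite minor_sum0 !minor_sum_add_delta /= minor_sum0.
  by rewrite mulr0 addr0.
have [Tj ratio] := IH (ltnW lt_jk); have {}ratio := ratio lt_jk.
have Tj1 := positive j lt_jk Tj ratio; split=> // lt_j2k.
apply: pencil_step ratio => //; last exact: ltW.
  by move=> t; have /= := newton t j.+1; rewrite !minor_sum_add_delta.
by apply: S_gt0; rewrite /= ltnW.
Qed.

(** The Newton-Maclaurin inequalities with the binomial factors cancelled: the
    product of Newton's inequalities between the indices [l] and [k]. *)
Lemma newton_maclaurin (R : rcfType) (n k l : nat) (M : 'M[R]_n) :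
    M^T = M -> (forall j, (1 <= j <= k.+1)%N -> 0 < minor_sum j M) ->
    (l <= k)%N ->
  k.+1%:R * (n%:R - l%:R) * (minor_sum k.+1 M * minor_sum l M)
  <= l.+1%:R * (n%:R - k%:R) * (minor_sum k M * minor_sum l.+1 M).
Proof.
move=> Msym; elim: k => [|k IH] S_gt0.
  by rewrite leqn0 => /eqP->; rewrite (mulrC (minor_sum 1 M)).
rewrite leq_eqVlt => /orP[/eqP->|lt_lk]; first by rewrite (mulrC (minor_sum k.+2 M)).
have {}IH : k.+1%:R * (n%:R - l%:R) * (minor_sum k.+1 M * minor_sum l M)
    <= l.+1%:R * (n%:R - k%:R) * (minor_sum k M * minor_sum l.+1 M).
  by apply: IH => // j /andP[j0 jk]; rewrite S_gt0 // j0 ltnW.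
have {S_gt0} S_gt0 j : (j <= k.+2)%N -> 0 < minor_sum j M.
  by case: j => [|j] lt_j; [rewrite minor_sum0 | apply: S_gt0].
have lt_kn : (k.+1 < n)%N.
  rewrite ltnNge; apply/negP => le_nk.
  by have := S_gt0 k.+2 (leqnn _); rewrite (minor_sum_gt Msym) ?ltxx.
have := newton_minor_sum k Msym.
have c_gt0 : 0 < (n%:R - k%:R) * minor_sum k M.
  by rewrite mulr_gt0 ?S_gt0 ?subr_gt0 ?ltr_nat // ltnW // ltnW.
have ca_ge0 : 0 <= (n%:R - l%:R) * minor_sum l M.
  by rewrite mulr_ge0 ?subr_ge0 ?ler_nat ?ltW ?S_gt0 //; lia.
have d_ge0 : 0 <= (n%:R - k.+1%:R) * minor_sum k.+1 M.
  by rewrite mulr_ge0 ?subr_ge0 ?ler_nat ?ltW ?S_gt0 //; lia.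
move=> newton; rewrite -(ler_pM2l c_gt0).
have le1 := ler_wpM2l ca_ge0 newton; have le2 := ler_wpM2l d_ge0 IH.
by move: le1 le2; clear; lra.
Qed.

(** The ratio inequality of [pminor_Gamma], chained between two sizes. *)
Lemma minor_sum_ratio (R : rcfType) (n j k : nat) (M : 'M[R]_n) (i : 'I_n) :
    M^T = M -> (forall j, (1 <= j <= k)%N -> 0 < minor_sum j M) ->
    (j <= k)%N ->
  minor_sum k M * dminor_sum j i M <= minor_sum j M * dminor_sum k i M.
Proof.
move=> Msym S_gt0; have [T_gt0 step] := pminor_Gamma i Msym S_gt0.
elim: k S_gt0 T_gt0 step => [|k IH] S_gt0 T_gt0 step.
  by rewrite leqn0 => /eqP->.
rewrite leq_eqVlt => /orP[/eqP->//|le_jk].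
case: k IH S_gt0 T_gt0 step le_jk => [|k] IH S_gt0 T_gt0 step le_jk.
  by move: le_jk; rewrite ltnS leqn0 => /eqP-> /=; rewrite !minor_sum0 mulr0 mulr1.
have {}IH : minor_sum k.+1 M * dminor_sum j i M
    <= minor_sum j M * dminor_sum k.+1 i M.
  apply: IH => // [p /andP[p0 pk]|p pk|p pk].
  - by rewrite S_gt0 // p0 ltnW.
  - by rewrite T_gt0 // ltnW.
  - by rewrite step // ltnW.
have Tk_gt0 : 0 < minor_sum k (pminor i M) by rewrite T_gt0.
have Tj_ge0 : 0 <= dminor_sum j i M.
  by clear IH; case: j le_jk => [|j] //= jk; rewrite ltW // T_gt0 // ltnW.
have Tk1_ge0 : 0 <= minor_sum k.+1 (pminor i M) by rewrite ltW // T_gt0.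
rewrite -(ler_pM2l Tk_gt0) /=.
have le1 := ler_wpM2l Tj_ge0 (step k (ltnSn _)); have le2 := ler_wpM2l Tk1_ge0 IH.
by move: le1 le2 => /=; clear; lra.
Qed.

Lemma sum_dminor_sum_bound (R : rcfType) (n k l : nat) (M : 'M[R]_n) :
    M^T = M -> (forall j, (1 <= j <= k.+1)%N -> 0 < minor_sum j M) ->
    (l <= k)%N ->
  k.+1%:R * (minor_sum k.+1 M * \sum_i dminor_sum l i M)
  <= l%:R * (n%:R - k%:R) * (minor_sum k M * minor_sum l M).
Proof.
move=> Msym S_gt0; case: l => [_|l lt_lk].
  by rewrite /= big1 // !mulr0 !mul0r.
rewrite sum_minor_sum_pminor.
have := newton_maclaurin Msym S_gt0 (ltnW lt_lk); apply: le_trans.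
by rewrite le_eqVlt; apply/orP; left; apply/eqP; ring.
Qed.

(** * The inequalities for an arrowhead matrix with negative corner *)

Lemma tr_pminor (R : Type) (n : nat) (i : 'I_n) (A : 'M[R]_n) :
  (pminor i A)^T = pminor i A^T.
Proof. by apply/matrixP => a b; rewrite !mxE. Qed.

Lemma dminor_sum_ge0 (R : rcfType) (n j : nat) (M : 'M[R]_n) (i : 'I_n) :
    M^T = M -> (forall p, (1 <= p <= j)%N -> 0 < minor_sum p M) ->
  0 <= dminor_sum j i M.
Proof.
move=> Msym S_gt0; case: j S_gt0 => [|j] S_gt0 //=.
by rewrite ltW //; have [-> //] := pminor_Gamma i Msym S_gt0.
Qed.

Lemma sym_entry_mul_ge0 (R : realDomainType) (n : nat) (A : 'M[R]_n) (i j : 'I_n) :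
  A^T = A -> 0 <= A i j * A j i.
Proof. by move=> Asym; rewrite -{2}Asym mxE -expr2 sqr_ge0. Qed.

(** The border contributes minus a combination of minor sums of submatrices of
    the block, with coefficients the squares of the border entries. *)
Lemma arrowhead_le (R : rcfType) (m k : nat) (A : 'M[R]_m.+1) :
    A^T = A -> is_diag_mx (pminor ord0 A) ->
    (forall j, (1 <= j <= k.+1)%N -> 0 < minor_sum j A) ->
  minor_sum k.+1 A <= minor_sum k.+1 (pminor ord0 A)
    + A ord0 ord0 * minor_sum k (pminor ord0 A).
Proof.
move=> Asym Adiag S_gt0; rewrite minor_sum_arrowhead // gerBl.
have [s_gt0 _] := pminor_Gamma ord0 Asym S_gt0.
apply: sumr_ge0 => i _.
rewrite mulr_ge0 //.
  exact: sym_entry_mul_ge0.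
apply: dminor_sum_ge0; first by rewrite tr_pminor Asym.
by move=> p /andP[_ pk]; apply: s_gt0.
Qed.

(** The block lies in the same cone [Gamma_k], one index more than a principal
    submatrix of a general matrix: this last positivity comes from the sign of the
    corner in [S_k <= s_k + a s_{k-1}]. *)
Lemma arrowhead_block_Gamma (R : rcfType) (m k : nat) (A : 'M[R]_m.+1) :
    A^T = A -> is_diag_mx (pminor ord0 A) -> A ord0 ord0 < 0 ->
    (forall j, (1 <= j <= k)%N -> 0 < minor_sum j A) ->
  forall j, (j <= k)%N -> 0 < minor_sum j (pminor ord0 A).
Proof.
move=> Asym Adiag a_lt0; case: k => [|k] S_gt0 j le_jk.
  by move: le_jk; rewrite leqn0 => /eqP->; rewrite minor_sum0.
have [s_gt0 _] := pminor_Gamma ord0 Asym S_gt0.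
move: le_jk; rewrite leq_eqVlt => /orP[/eqP->|]; last exact: s_gt0.
have Sk_gt0 := S_gt0 k.+1 (leqnn _).
apply: (lt_le_trans (lt_le_trans Sk_gt0 (arrowhead_le Asym Adiag S_gt0))).
by rewrite gerDl nmulr_rle0 // ltW // s_gt0.
Qed.

Lemma minor_sum_le_block (R : rcfType) (m k j : nat) (A : 'M[R]_m.+1) :
    A^T = A -> is_diag_mx (pminor ord0 A) -> A ord0 ord0 < 0 ->
    (forall j, (1 <= j <= k)%N -> 0 < minor_sum j A) -> (j <= k)%N ->
  minor_sum j A <= minor_sum j (pminor ord0 A).
Proof.
move=> Asym Adiag a_lt0 S_gt0; case: j => [|j] lt_jk; first by rewrite !minor_sum0.
have S_gt0' p : (1 <= p <= j.+1)%N -> 0 < minor_sum p A.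
  by move=> /andP[p0 pj]; rewrite S_gt0 // p0 (leq_trans pj).
apply: le_trans (arrowhead_le Asym Adiag S_gt0') _; rewrite gerDl nmulr_rle0 //.
by rewrite ltW // (arrowhead_block_Gamma Asym Adiag a_lt0 S_gt0) // ltnW.
Qed.

(** Positivity of [S_{j+1} <= s_{j+1} + a s_j] makes the sums [s_j] of the block
    grow at least geometrically, with ratio [- a]. *)
Lemma block_growth (R : rcfType) (m k l : nat) (A : 'M[R]_m.+1) :
    A^T = A -> is_diag_mx (pminor ord0 A) -> A ord0 ord0 < 0 ->
    (forall j, (1 <= j <= k)%N -> 0 < minor_sum j A) -> (l <= k)%N ->
  (- A ord0 ord0) ^+ (k - l) * minor_sum l (pminor ord0 A)
  <= minor_sum k (pminor ord0 A).
Proof.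
move=> Asym Adiag a_lt0; elim: k => [|k IH] S_gt0.
  by rewrite leqn0 => /eqP->; rewrite subn0 mul1r.
rewrite leq_eqVlt => /orP[/eqP->|le_lk]; first by rewrite subnn mul1r.
have S_gt0' p : (1 <= p <= k)%N -> 0 < minor_sum p A.
  by move=> /andP[p0 pk]; rewrite S_gt0 // p0 ltnW.
have a_ge0 : 0 <= - A ord0 ord0 by rewrite oppr_ge0 ltW.
have {}IH := ler_wpM2l a_ge0 (IH S_gt0' le_lk).
rewrite subSn // exprS -mulrA; apply: le_trans IH _.
have := lt_le_trans (S_gt0 k.+1 (leqnn _)) (arrowhead_le Asym Adiag S_gt0).
by rewrite mulNr -subr_ge0 opprK => /ltW.
Qed.

(** Writing [S_j = s_j + a s_{j-1} - B_j], each of the three parts satisfies the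
    inequality separately: the first by Newton-Maclaurin for the block, the
    second because [a < 0] and [l (n - k) <= k (n - l)], the third by the
    monotonicity of the quotients of minor sums of the block. *)
Lemma arrowhead_corner_bound (R : rcfType) (m k l : nat) (n := m.+1)
    (A : 'M[R]_n) :
    A^T = A -> is_diag_mx (pminor ord0 A) -> A ord0 ord0 < 0 ->
    (forall j, (1 <= j <= k.+1)%N -> 0 < minor_sum j A) -> (l <= k)%N ->
  k.+1%:R * (n%:R - l%:R) * (minor_sum k.+1 A * dminor_sum l ord0 A)
  <= l%:R * (n%:R - k.+1%:R) * (minor_sum k (pminor ord0 A) * minor_sum l A).
Proof.
move=> Asym Adiag a_lt0 S_gt0; case: l => [_|l lt_lk].
  by rewrite /= !mulr0 !mul0r.
have s_gt0 := arrowhead_block_Gamma Asym Adiag a_lt0 S_gt0.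
rewrite /= !minor_sum_arrowhead //.
set D := pminor ord0 A in s_gt0 *.
have Dsym : D^T = D by rewrite tr_pminor Asym.
have D_gt0 j : (1 <= j <= k.+1)%N -> 0 < minor_sum j D.
  by move=> /andP[_]; apply: s_gt0.
have D_gt0' j : (1 <= j <= k)%N -> 0 < minor_sum j D.
  by move=> /andP[_ jk]; apply: s_gt0; apply: ltnW.
have NM := newton_maclaurin Dsym D_gt0 (ltnW lt_lk).
have lt_km : (k.+1 <= m)%N.
  rewrite leqNgt; apply/negP => lt_mk.
  by have := s_gt0 k.+1 (leqnn _); rewrite (minor_sum_gt Dsym) // ltxx.
have b_ge0 i : 0 <= A ord0 (lift ord0 i) * A (lift ord0 i) ord0.
  exact: sym_entry_mul_ge0.
set B := fun j => \sum_i (A ord0 (lift ord0 i) * A (lift ord0 i) ord0)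
  * dminor_sum j i D.
rewrite -/(B k) -/(B l).
have Bl_ge0 : 0 <= B l.
  apply: sumr_ge0 => i _; rewrite mulr_ge0 // dminor_sum_ge0 // => p /andP[_ pl].
  by apply: s_gt0; apply: leq_trans pl (ltnW (ltnW _)).
have ratio : minor_sum k D * B l <= minor_sum l D * B k.
  rewrite !mulr_sumr; apply: ler_sum => i _; rewrite mulrCA [X in _ <= X]mulrCA.
  by rewrite ler_wpM2l // minor_sum_ratio // ltnW.
have nE p : n%:R - p.+1%:R = m%:R - p%:R :> R by rewrite -!natr1; ring.
rewrite !nE.
have L_ge0 : 0 <= l.+1%:R * (m%:R - k%:R) :> R.
  by rewrite mulr_ge0 // subr_ge0 ler_nat ltnW.
have LK : l.+1%:R * (m%:R - k%:R) <= k.+1%:R * (m%:R - l%:R) :> R.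
  apply: ler_pM => //; first by rewrite subr_ge0 ler_nat ltnW.
    by rewrite ler_nat ltnS ltnW.
  by rewrite lerD2l lerN2 ler_nat ltnW.
move: (A ord0 ord0) a_lt0 (s_gt0 k (leqnSn k)) (s_gt0 l (leqW (ltnW lt_lk))) => a.
move: (l.+1%:R * (m%:R - k%:R) : R) (k.+1%:R * (m%:R - l%:R) : R) LK L_ge0 NM => L K.
move: (minor_sum k D) (minor_sum l D) (minor_sum k.+1 D) (minor_sum l.+1 D) (B k) (B l)
  Bl_ge0 ratio.
clear => sk sl sk1 sl1 Bk Bl Bl0 ratio LK L0 NM a0 sk0 sl0.
have K0 := le_trans L0 LK.
have corner : 0 <= (K - L) * (- a * (sk * sl)).
  apply: mulr_ge0; first by rewrite subr_ge0.
  by apply: mulr_ge0; rewrite ?oppr_ge0 ltW // mulr_gt0.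
have border1 : 0 <= K * (sl * Bk - sk * Bl) by rewrite mulr_ge0 // subr_ge0.
have border2 : 0 <= (K - L) * (sk * Bl).
  by apply: mulr_ge0; [rewrite subr_ge0 | rewrite mulr_ge0 // ltW].
lra.
Qed.

(** * Derivatives of the quotients *)

(** Along [A + t E_ii] both sums are affine in [t], so that the directional
    derivative is the ordinary derivative at [0] of a quotient of affine
    functions. *)
Lemma partial_diag_sigma_quotient (R : realType) (m k l : nat) (i : 'I_m.+1)
    (A : 'M[R]_m.+1) :
    A^T = A -> minor_sum l A != 0 ->
  partial_diag (sigma_quotient k l) i A
  = (dminor_sum k i A * minor_sum l A - minor_sum k A * dminor_sum l i A)
    / minor_sum l A ^+ 2.
Proof.
move=> Asym Sl_neq0.
have line j t : sigma_mx j (A + t *: delta_mx i i) = minor_sum j A + t * dminor_sum j i A.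
  rewrite /sigma_mx sigma_eigenvalues; last first.
    by rewrite linearD linearZ /= trmx_delta Asym.
  exact: minor_sum_add_delta.
set a := minor_sum k A; set b := dminor_sum k i A.
set c := minor_sum l A; set d := dminor_sum l i A.
pose g (t : R) := (a + t * b) / (c + t * d).
have -> : partial_diag (sigma_quotient k l) i A = 'D_1 (g : R -> R) (0 : R).
  rewrite /partial_diag /derive; congr (lim (_ @ 0^'))%classic; apply/funext => h /=.
  rewrite addr0 -[A in _ - sigma_quotient k l A]addr0 -(scale0r (delta_mx i i)).
  rewrite [h *: _ + A]addrC /sigma_quotient !line /g.
  by rewrite /GRing.scale /= mulr1.
pose P (x y : R) : {poly R} := x%:P + y *: 'X.
have PE x y t : (P x y).[t] = x + t * y by rewrite !hornerE mulrC.
have dP x y : is_derive (0 : R) (1 : R) (horner (P x y)) y.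
  apply: is_derive_eq.
  by rewrite /P derivD derivC derivZ derivX add0r alg_polyC hornerC.
have [dN eN] := dP a b; have [dD eD] := dP c d.
have D0 : (P c d).[0] != 0 by rewrite PE mul0r addr0.
have -> : g = horner (P a b) * (fun t => (horner (P c d) t)^-1) :> (R -> R).
  by apply/funext => t /=; rewrite /g -!PE.
rewrite (deriveM dN (derivableV D0 dD)) (deriveV D0 dD) eN eD !PE !mul0r !addr0.
rewrite /GRing.scale /=.
by field.
Qed.

(** Up to the common positive factor [g^2], the corner derivative is at least
    the part [N (K - L) / (K (N - L)) c' g] of its first term, and the sum of all
    of them at most its first term. *)
Lemma corner_derivative_numeric (R : realFieldType) (N K L c c' e g d0 w : R) :
    K * (N - L) * (e * d0) <= L * (N - K) * (c' * g) ->
    0 <= e * w -> c <= c' -> 0 < g -> 0 <= L -> L + 1 <= K -> K <= N ->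
  N / K * ((K - L) / (N - L)) * (1 / (N - K + 1))
    * (((N - (K - 1)) * c * g - e * w) / g ^+ 2)
  <= (c' * g - e * d0) / g ^+ 2.
Proof.
move=> corner ew cc' g_gt0 L_ge0 LK KN.
have K_gt0 : 0 < K by lra.
have NL_gt0 : 0 < N - L by lra.
have NK_gt0 : 0 < N - K + 1 by lra.
rewrite mulrA ler_pM2r ?invr_gt0 ?exprn_gt0 //.
set r := N / K * ((K - L) / (N - L)).
have r_ge0 : 0 <= r by rewrite !mulr_ge0 ?invr_ge0; lra.
have rE : K * (N - L) * r = N * (K - L).
  by rewrite /r; field; rewrite !gt_eqF.
apply: (@le_trans _ _ (r * (c' * g))).
  rewrite -mulrA ler_wpM2l // div1r mulrC ler_pdivrMr //.
  have : 0 <= (N - K + 1) * ((c' - c) * g).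
    by rewrite mulr_ge0 ?(ltW NK_gt0) // mulr_ge0 ?subr_ge0 // ltW.
  lra.
rewrite -(ler_pM2l (mulr_gt0 K_gt0 NL_gt0)) [leLHS]mulrA rE; lra.
Qed.

(** Here the lower bound of the whole sum by a part of its first term comes from
    the Newton-Maclaurin inequality for the full matrix, and that first term
    dominates the minor sum [c'] of a single principal submatrix. *)
Lemma total_derivative_numeric (R : realFieldType) (N K L c c' e g w q b sl : R) :
    K * (e * w) <= L * (N - (K - 1)) * (c * g) ->
    c' <= (N - (K - 1)) * c -> q * sl <= c' -> g <= sl ->
    0 <= q -> 0 <= b -> b <= 1 -> 0 < g -> 0 < K -> L <= K ->
  (K - L) / K * b * q <= ((N - (K - 1)) * c * g - e * w) / g ^+ 2.
Proof.
move=> total c'c qc' g_sl q_ge0 b_ge0 b_le1 g_gt0 K_gt0 LK.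
set X := (N - (K - 1)) * c in c'c *.
have LK_ge0 : 0 <= K - L by rewrite subr_ge0.
have qg : q * g <= X.
  by apply: le_trans c'c; apply: le_trans qc'; rewrite ler_wpM2l.
rewrite ler_pdivlMr ?exprn_gt0 // -(ler_pM2l K_gt0).
have -> : K * ((K - L) / K * b * q * g ^+ 2) = (K - L) * (b * (q * g * g)).
  by field; rewrite gt_eqF.
apply: (@le_trans _ _ ((K - L) * (X * g))).
  rewrite ler_wpM2l //; apply: (@le_trans _ _ (q * g * g)).
    by rewrite ler_piMl // !mulr_ge0 // ltW.
  by rewrite ler_wpM2r // ltW.
by move: total; rewrite /X; lra.
Qed.

Theorem lemma2p6 (R : realType) (m : nat) (n := m.+1) (k : nat)
    (A : 'M[R]_n)
    (hk1 : (1 <= k)%N) (hkn : (k <= n)%N)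
    (Asym : A^T = A)
    (a11_neg : A ord0 ord0 < 0)
    (Adiag : is_diag_mx (row' ord0 (col' ord0 A)))
    (AGamma : Gamma k (eigenvalues A)) :
  forall l : nat, (l < k)%N ->
    partial_diag (sigma_quotient k l) ord0 A >=
      (n%:R / k%:R) * ((k%:R - l%:R) / (n%:R - l%:R)) *
      (1 / (n%:R - k%:R + 1)) *
      \sum_(i < n) partial_diag (sigma_quotient k l) i A
    /\
    \sum_(i < n) partial_diag (sigma_quotient k l) i A >=
      ((k%:R - l%:R) / k%:R) * (1 / 'C(n, l)%:R) *
      (- A ord0 ord0) ^+ (k - l - 1).
Proof.
move=> l lt_lk.
have S_gt0 j : (1 <= j <= k)%N -> 0 < minor_sum j A.
  by move=> jk; rewrite -sigma_eigenvalues //; apply: AGamma.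
case: k hk1 hkn lt_lk S_gt0 {AGamma} => // k _ lt_kn le_lk S_gt0.
rewrite ltnS in le_lk.
have Sl_gt0 : 0 < minor_sum l A.
  by case: l le_lk => [|l] lk; rewrite ?minor_sum0 // S_gt0 //= ltnW.
have Sk_gt0 : 0 < minor_sum k A.
  by case: k S_gt0 {lt_kn le_lk} => [|k] S0; rewrite ?minor_sum0 // S0 //= ltnW.
have quot i := partial_diag_sigma_quotient k.+1 i Asym (lt0r_neq0 Sl_gt0).
rewrite (eq_bigr _ (fun i _ => quot i)) quot -mulr_suml sumrB -mulr_suml -mulr_sumr.
rewrite sum_minor_sum_pminor /=.
have corner := arrowhead_corner_bound Asym Adiag a11_neg S_gt0 le_lk.
have total := sum_dminor_sum_bound Asym S_gt0 le_lk.
have d_ge0 : 0 <= \sum_i dminor_sum l i A.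
  apply: sumr_ge0 => i _; apply: dminor_sum_ge0 => // p /andP[p0 pl].
  by rewrite S_gt0 // p0 (leq_trans pl) // ltnW.
have Sk_sk : minor_sum k A <= minor_sum k (pminor ord0 A).
  by apply: (minor_sum_le_block Asym Adiag a11_neg S_gt0); apply: leqnSn.
have Sl_sl : minor_sum l A <= minor_sum l (pminor ord0 A).
  by apply: (minor_sum_le_block Asym Adiag a11_neg S_gt0); apply: leqW.
have growth : (- A ord0 ord0) ^+ (k - l) * minor_sum l (pminor ord0 A)
    <= minor_sum k (pminor ord0 A).
  apply: block_growth => // p /andP[p0 pk].
  by rewrite S_gt0 // p0 ltnW.
have sk_sum : minor_sum k (pminor ord0 A) <= (n%:R - k%:R) * minor_sum k A.
  rewrite -sum_minor_sum_pminor (bigD1 ord0) //= lerDl.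
  apply: sumr_ge0 => i _; have [T_gt0 _] := pminor_Gamma i Asym S_gt0.
  exact/ltW/T_gt0.
have Sk1_gt0 := S_gt0 k.+1 (leqnn _).
rewrite subSn // subn1 [_.+1.-1]/=.
have q_ge0 : 0 <= (- A ord0 ord0) ^+ (k - l).
  by rewrite exprn_ge0 // oppr_ge0 ltW.
have le_ln : (l <= n)%N by apply: leq_trans le_lk (ltnW lt_kn).
have binom_le1 : 1 / 'C(n, l)%:R <= 1 :> R.
  by rewrite div1r invf_le1 ?ltr0n ?ler1n bin_gt0.
have binom_ge0 : 0 <= 1 / 'C(n, l)%:R :> R by rewrite div1r invr_ge0.
have kl : l%:R + 1 <= k.+1%:R :> R by rewrite natr1 ler_nat.
have kn : k.+1%:R <= n%:R :> R by rewrite ler_nat.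
have k0 : 0 < k.+1%:R :> R by rewrite ltr0n.
have l0 : 0 <= l%:R :> R by rewrite ler0n.
have kE : k%:R = k.+1%:R - 1 :> R by rewrite -natr1 addrK.
rewrite kE in total sk_sum; rewrite kE; split.
  apply: corner_derivative_numeric => //.
  by apply: mulr_ge0 => //; apply: ltW.
apply: (@total_derivative_numeric _ _ _ _ _ _ _ _ _ _ _ _ total sk_sum growth) => //.
by apply: le_trans kl; rewrite lerDl.
Qed.
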